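(* Let $\lambda,\mu$ be partitions with $D(\mu)\subset D(\lambda)$, let $N$ be a positive integer, let $\boldsymbol s=(s_{ij})\in T^{\mathrm{diag}}(\lambda/\mu,\mathbb C)$, i.e. $s_{ij}=a_{j-i}$ for a family $(a_c)_{c\in\mathbb Z}$ of complex numbers, and let $(\theta_1,\ldots,\theta_n)$ be any outside decomposition of $\lambda/\mu$. Then \[ S^{\mathrm{so},N}_{\lambda/\mu}(\boldsymbol s)=\det\left(S^{\mathrm{so},N}_{\theta_i\#\theta_j}(\boldsymbol s_{\theta_i}\#\boldsymbol s_{\theta_j})\right)_{1\le i,j\le n}, \] where $\boldsymbol s_{\theta_i}\#\boldsymbol s_{\theta_j}$ is the filling of $\theta_i\#\theta_j$ having $a_c$ in its box of content $c$, and the $(i,j)$ entry is $1$ if $\theta_i\#\theta_j=\emptyset$ and $0$ if $\theta_i\#\theta_j$ is undefined.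
   Context: Diagrams. For a partition $\lambda=(\lambda_1,\ldots,\lambda_r)$, $D(\lambda)=\{(i,j): 1\le i\le r,\ 1\le j\le\lambda_i\}$ (row $i$ downwards, column $j$ to the right), and $D(\lambda/\mu)=D(\lambda)\setminus D(\mu)$. The content of box $(i,j)$ is $j-i$. $T^{\mathrm{diag}}(\lambda/\mu,\mathbb C)$ is the set of complex fillings of $D(\lambda/\mu)$ that are constant on diagonals of fixed content. Orthogonal quasi-symmetric functions. Let $[\overline N]^\infty=\{1<\overline1<2<\overline2<\cdots<N<\overline N<\infty\}$, with $|i|=i$, $|\overline i|=i^{-1}$, $|\infty|=1$. Let $E$ be a skew diagram, or a strip whose boxes carry prescribed contents. An so-tableau of shape $E$ is a filling of $E$ with letters of $[\overline N]^\infty$ such that: (SO1) entries are weakly increasing along each row (left to right); (SO2) entries are strictly increasing down each column; (SO3) each box of content $-i$ has entry $\ge i+1$ (vacuous for $-i\ge0$); (SO4) the entries equal to $\infty$ form a shape such that no two symbols $\infty$ appear in the same row. For a complex filling $\boldsymbol s$ of $E$, the orthogonal quasi-symmetric function is $S_E^{\mathrm{so},N}(\boldsymbol s)=\sum_M\prod_{\alpha\in E}|m_\alpha|^{s_\alpha}$, summed over all so-tableaux $M=(m_\alpha)$ of shape $E$; $S^{\mathrm{so},N}_{\lambda/\mu}$ is the case $E=D(\lambda/\mu)$. Outside decompositions. A strip is an edgewise connected skew diagram containing no $2\times2$ block; its starting box is its bottommost-leftmost box and its ending box is its topmost-rightmost box. A box $(i,j)$ of a diagram is on its left (resp. right, top,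 bottom) perimeter if $(i,j-1)$ (resp. $(i,j+1)$, $(i-1,j)$, $(i+1,j)$) is not in the diagram. An outside decomposition of $\lambda/\mu$ is an ordered set $(\theta_1,\ldots,\theta_n)$ of strips whose disjoint union is $D(\lambda/\mu)$, each having its starting box on the left or bottom perimeter of $D(\lambda/\mu)$ and its ending box on the right or top perimeter. Operation $\#$. A non-starting box of a strip is approached from the left (resp. from below) if the preceding box of the strip is immediately to its left (resp. below it). It is known that, for each content $c$, a direction $d(c)\in\{\text{left},\text{below}\}$ can be chosen so that every non-starting box of content $c$ in the strips is approached from direction $d(c)$, and every starting box of content $c$ is on the left perimeter if $d(c)=\text{left}$ and on the bottom perimeter if $d(c)=\text{below}$; if no box of $D(\lambda/\mu)$ has content $c$ then $d(c)$ is chosen arbitrarily. Fix such choices. For $p\le q$ let $R[p,q]$ be the strip with exactly one box of each content $p,p+1,\ldots,q$, where the box of content $c$ ($p<c\le q$) is immediately to the right of the box of content $c-1$ if $d(c)=\text{left}$ and immediately above it if $d(c)=\text{below}$. If $p_i$ and $q_i$ denote the contents of the starting and ending boxes of $\theta_i$ (so $\theta_i$ is a diagonal translate of $R[p_i,q_i]$), then $\theta_i\#\theta_j=R[p_j,q_i]$ if $p_j\le q_i$, $\theta_i\#\theta_j=\emptyset$ if $p_j=q_i+1$, and $\theta_i\#\theta_j$ is undefined if $p_j>q_i+1$. Boxes of $\theta_i\#\theta_j$ keep their contents $p_j,\ldots,q_i$.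
   Formalization: In (SO2), strict increase down columns is required only of letters other than ∞; ∞ may repeat down a column (but not in a row). With strictness for ∞ too, the formula fails: N=1, λ=(1,1), s=0, two single-box strips give 2 on the left but determinant 3. *)

(* Defs.v *)
From mathcomp Require Import all_boot all_order all_algebra.
From mathcomp Require Import finmap complex.
From mathcomp Require Import reals sequences exp trigo.

Set Implicit Arguments.
Unset Strict Implicit.
Unset Printing Implicit Defensive.

Import Order.TTheory GRing.Theory Num.Theory.

Local Open Scope fset_scope.
Local Open Scope ring_scope.

(* A box is a pair (row, column), rows numbered downwards.  Coordinates are
   integers so that a strip can be placed on the diagonals prescribed by the
   contents of its boxes. *)
Definition box := (int * int)%type.
Definition content (b : box) : int := b.2 - b.1.
Definition left_box (b : box) : box := (b.1, b.2 - 1).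
Definition right_box (b : box) : box := (b.1, b.2 + 1).
Definition top_box (b : box) : box := (b.1 - 1, b.2).
Definition bottom_box (b : box) : box := (b.1 + 1, b.2).

Definition is_partition (l : seq nat) : bool := sorted geq l && (0%N \notin l).

Definition diagram (l : seq nat) : {fset box} :=
  [fset ((i%:Z, j%:Z) : box) | i in iota 1 (size l),
                               j in iota 1 (nth 0%N l i.-1)].

Definition skew_diagram (l m : seq nat) : {fset box} :=
  diagram l `\` diagram m.

(* The alphabet 1 < bar 1 < ... < N < bar N < oo: [Some (k, false)] is the
   letter k + 1, [Some (k, true)] is bar (k + 1), and [None] is oo. *)
Notation letter N := (option ('I_N * bool)).

Definition letter_lt (N : nat) (a b : letter N) : bool :=
  match a, b with
  | Some (k, x), Some (l, y) => (k < l)%N || [&& k == l, ~~ x & y]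
  | Some _, None => true
  | None, _ => false
  end.

Definition letter_le (N : nat) (a b : letter N) : bool :=
  (a == b) || letter_lt a b.

(* [letter_ge_num a i]: a is at least the unbarred letter i, where i may
   exceed N, in which case only oo qualifies. *)
Definition letter_ge_num (N : nat) (a : letter N) (i : nat) : bool :=
  if a is Some (k, _) then (i <= k.+1)%N else true.

Definition letter_abs (R : realType) (N : nat) (a : letter N) : R :=
  match a with
  | Some (k, false) => k.+1%:R
  | Some (k, true) => k.+1%:R^-1
  | None => 1
  end.

(* In so2, strictness is required of the letters other than oo only.  The
   letter oo is governed by so4 instead: it may be repeated down a column but
   not along a row (its boxes form a vertical strip), as in Sundaram's
   so(2N+1)-tableaux.  If repeated oo's were also excluded from columns, the
   determinantal formula would fail: for N = 1, the shape (1, 1) and its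
   decomposition into rows, there would be 2 tableaux but the determinant
   would be 3 * 1 - 0 * 1. *)
Section Tableaux.
Variables (N : nat) (E : {fset box}) (M : {ffun E -> letter N}).

Definition so1 : bool := [forall x : E, forall y : E,
  ((val x).1 == (val y).1) && ((val x).2 < (val y).2) ==>
  letter_le (M x) (M y)].

Definition so2 : bool := [forall x : E, forall y : E,
  ((val x).2 == (val y).2) && ((val x).1 < (val y).1) ==>
  letter_lt (M x) (M y) || ((M x == None) && (M y == None))].

Definition so3 : bool := [forall x : E,
  (content (val x) <= 0) ==> letter_ge_num (M x) `|content (val x)|%N.+1].

Definition so4 : bool := [forall x : E, forall y : E,
  [&& (val x).1 == (val y).1, M x == None & M y == None] ==> (x == y)].

Definition so_tableau : bool := [&& so1, so2, so3 & so4].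

End Tableaux.

Section ComplexPower.
Variable R : realType.

Definition cexp (z : R[i]) : R[i] :=
  let: Complex x y := z in Complex (expR x * cos y) (expR x * sin y).

(* x ^ s = exp (s ln x), for x > 0 *)
Definition cpow (x : R) (s : R[i]) : R[i] := cexp (s * (Complex (ln x) 0)).

End ComplexPower.

Definition so_fun (R : realType) (N : nat) (E : {fset box})
    (s : box -> R[i]) : R[i] :=
  \sum_(M : {ffun E -> letter N} | so_tableau M)
    \prod_(x : E) cpow (letter_abs R (M x)) (s (val x)).

Definition adjacent (b c : box) : bool :=
  c \in [:: left_box b; right_box b; top_box b; bottom_box b].

Definition edgewise_connected (E : {fset box}) : Prop :=
  forall b c, b \in E -> c \in E ->
  exists p : seq box,
    [/\ path adjacent b p, {subset p <= E} & last b p = c].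

Definition is_skew_diagram (E : {fset box}) : Prop :=
  exists l m : seq nat,
    [/\ is_partition l, is_partition m, diagram m `<=` diagram l
      & E = skew_diagram l m].

Definition has_no_2x2_block (E : {fset box}) : Prop :=
  forall b, ~ [/\ b \in E, right_box b \in E, bottom_box b \in E
                & right_box (bottom_box b) \in E].

Definition is_strip (E : {fset box}) : Prop :=
  [/\ E != fset0, is_skew_diagram E, edgewise_connected E
    & has_no_2x2_block E].

Definition is_starting_box (E : {fset box}) (b : box) : Prop :=
  b \in E /\ forall c, c \in E -> c.1 <= b.1 /\ b.2 <= c.2.

Definition is_ending_box (E : {fset box}) (b : box) : Prop :=
  b \in E /\ forall c, c \in E -> b.1 <= c.1 /\ c.2 <= b.2.

Definition on_left_perimeter (D : {fset box}) (b : box) : bool :=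
  (b \in D) && (left_box b \notin D).
Definition on_right_perimeter (D : {fset box}) (b : box) : bool :=
  (b \in D) && (right_box b \notin D).
Definition on_top_perimeter (D : {fset box}) (b : box) : bool :=
  (b \in D) && (top_box b \notin D).
Definition on_bottom_perimeter (D : {fset box}) (b : box) : bool :=
  (b \in D) && (bottom_box b \notin D).

Definition outside_decomposition (D : {fset box}) (n : nat)
    (theta : 'I_n -> {fset box}) : Prop :=
  [/\ forall i, is_strip (theta i),
      forall i j, i != j -> [disjoint theta i & theta j]%fset,
      forall b, (b \in D) = [exists i, b \in theta i],
      forall i b, is_starting_box (theta i) b ->
        on_left_perimeter D b || on_bottom_perimeter D b
    & forall i b, is_ending_box (theta i) b ->
        on_right_perimeter D b || on_top_perimeter D b].

Inductive direction := FromLeft | FromBelow.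

Definition prev_box (d : direction) (b : box) : box :=
  match d with FromLeft => left_box b | FromBelow => bottom_box b end.

Definition next_box (d : direction) (b : box) : box :=
  match d with FromLeft => right_box b | FromBelow => top_box b end.

(* A box of a strip whose left (resp. bottom) neighbour belongs to the strip
   is preceded by that neighbour. *)
Definition compatible_directions (D : {fset box}) (n : nat)
    (theta : 'I_n -> {fset box}) (d : int -> direction) : Prop :=
  (forall i b, b \in theta i -> ~ is_starting_box (theta i) b ->
     prev_box (d (content b)) b \in theta i) /\
  (forall i b, is_starting_box (theta i) b ->
     match d (content b) with
     | FromLeft => on_left_perimeter D b
     | FromBelow => on_bottom_perimeter D b
     end).

(* The box of content p + k of R[p, q].  The strip R[p, q] is only defined up
   to diagonal translation; its box of content p is put at (0, p). *)
Fixpoint strip_box (d : int -> direction) (p : int) (k : nat) : box :=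
  match k with
  | 0%N => (0, p)
  | k'.+1 => next_box (d (p + k'.+1%:Z)) (strip_box d p k')
  end.

(* R[p, q], for p <= q *)
Definition content_strip (d : int -> direction) (p q : int) : {fset box} :=
  [fset strip_box d p k | k in iota 0 `|q - p|%N.+1].

(* theta_i # theta_j, as a function of the content qi of the ending box of
   theta_i and the content pj of the starting box of theta_j; [None] means
   undefined. *)
Definition sharp (d : int -> direction) (qi pj : int) : option {fset box} :=
  if pj <= qi then Some (content_strip d pj qi)
  else if pj == qi + 1 then Some fset0
  else None.

Definition sharp_entry (R : realType) (N : nat) (a : int -> R[i])
    (E : option {fset box}) : R[i] :=
  match E with
  | Some F => if F == fset0 then 1 else so_fun N F (fun b => a (content b))
  | None => 0
  end.

(* Main.v *)
Require Import Defs.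
From mathcomp Require Import all_boot all_order all_algebra.
From mathcomp Require Import finmap complex.
From mathcomp Require Import reals sequences exp trigo.
From mathcomp Require Import perm zify.

(** Write [X u v] for: the letter v may stand immediately to the right of u.
    For so-tableaux this means u <= v and u != oo, and v may stand immediately
    above u exactly when [X u v] fails.  This complementarity is all that the
    proof uses about the alphabet, besides a monotonicity of [X]; the lower
    bounds on the entries depend only on the content and the letter, so they
    are absorbed into the weights, which are otherwise arbitrary.

    The diagram is swept diagonal by diagonal, in the order of contents.  When
    the sweep has reached content c, each strip is unstarted, finished, or
    alive, in which case it has one box on the diagonal c.  Assign to it the
    row, indexed by the strips j, which is a unit vector if it is unstarted,
    the final row of the determinant if it is finished, and, if it is alive and
    its box on the diagonal carries the letter v, the generating function of
    the fillings of R[p_j, c] whose last letter is v.  The determinant of this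
    matrix turns out to be the generating function of the fillings of the part
    of the diagram of content at most c with the given letters on the diagonal
    c.  The invariant [partial_sum c] multiplies it by the weights of all ways
    to complete the filling: it is the sum over all tableaux when c precedes
    every content, and the determinant of the theorem when c exceeds every
    content.

    That the invariant does not change from c to c + 1 ([partial_sumS]) is a
    row reduction.  In the matrix for c + 1, the row of a strip whose next box
    carries v is, up to its weight, the sum of the rows y_u for content c over
    the letters u that may precede v.  A box x on the diagonal c has one
    neighbour on the diagonal c + 1 in its own strip, and possibly another one,
    in another strip.  Subtracting the row of that other strip leaves the sum of
    y_u over those u compatible with both neighbours of x
    ([row_minus_beside]).  By multilinearity the determinant is then the sum,
    over all letters on the diagonal c compatible with those on the diagonal
    c + 1, of the determinants for c.  The reduction is unitriangular, because
    the neighbour in another strip always lies on the same side along the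
    diagonal.

    The argument works for every order-convex set of boxes
    ([sum_fillings_det]).  Applied to R[p, q], decomposed into the single strip
    R[p, q], it identifies the entries of the determinant. *)

Set Implicit Arguments.
Unset Strict Implicit.

Import Order.TTheory GRing.Theory Num.Theory.

Local Open Scope fset_scope.
Local Open Scope ring_scope.

(** * Determinants *)

(** A permutation s other than the identity contributes 0 to the Leibniz
    formula: otherwise r (s i) <= r i for all i, strictly wherever s moves i,
    while both sides have the same sum over i. *)
Lemma det_one_minus_decreasing (K : comNzRingType) (n : nat)
    (e : rel 'I_n) (r : 'I_n -> int) :
  (forall i k, e i k -> r k < r i) ->
  \det (\matrix_(i < n, k < n) ((i == k)%:R - (e i k)%:R) : 'M[K]_n) = 1.
Proof.
move=> er; rewrite /determinant (bigD1 (1%g : {perm 'I_n})) //=.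
rewrite odd_perm1 expr0 mul1r.
rewrite [X in X + _]big1 => [|i _]; last first.
  rewrite mxE perm1 eqxx; case: (boolP (e i i)) => [/er|].
    by rewrite ltxx.
  by rewrite subr0.
rewrite big1 ?addr0 // => s s1.
have [i eis|noe] := pickP (fun i => (s i != i) && ~~ e i (s i)).
  case/andP: eis => sii nei; rewrite (bigD1 i) //= mxE (negPf nei).
  by rewrite eq_sym (negPf sii) subrr mul0r mulr0.
have rle i : r (s i) <= r i.
  have := noe i; case: eqVneq => [->//|_] /= /negbFE /er /ltW //.
have sum0 : \sum_i (r i - r (s i)) = 0.
  by rewrite sumrB (reindex_inj (@perm_inj _ s)) /= subrr.
have sub_ge0 i : true -> 0 <= r i - r (s i) by rewrite subr_ge0.
have allz i : r i - r (s i) = 0.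
  by move/psumr_eq0P: sum0 => /(_ sub_ge0 i isT).
case/negP: s1; apply/eqP/permP => i; rewrite perm1.
have := noe i; case: eqVneq => [->//|_] /= /negbFE /er.
by move: (allz i) => /subr0_eq ->; rewrite ltxx.
Qed.

Lemma det_family_sum (K : comNzRingType) (n : nat) (L : finType)
    (T : 'I_n -> pred L) (F : 'I_n -> L -> 'I_n -> K) :
  \det (\matrix_(i < n, j < n) \sum_(v | T i v) F i v j) =
  \sum_(u in family T)
     \det (\matrix_(i < n, j < n) F i (u i) j).
Proof.
rewrite /determinant exchange_big /=; apply: eq_bigr => s _.
rewrite -big_distrr /=; congr (_ * _).
under eq_bigr do rewrite mxE.
rewrite bigA_distr_big_dep; apply: eq_bigr => u _.
by apply: eq_bigr => i _; rewrite mxE.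
Qed.

(** Both expansions along column k have a single nonzero term, and its
    cofactor avoids row k. *)
Lemma det_eq_off_row (K : comNzRingType) (n : nat) (A B : 'M[K]_n)
    (k : 'I_n) :
  (forall i j, i != k -> A i j = B i j) -> A k k = B k k ->
  (forall i, i != k -> A i k = 0) ->
  \det A = \det B.
Proof.
move=> AB ABk A0; rewrite (expand_det_col A k) (expand_det_col B k).
rewrite (bigD1 k) //= [RHS](bigD1 k) //=.
congr (_ + _); last first.
  by rewrite !big1 // => i ik; rewrite -?AB ?A0 ?mul0r.
rewrite ABk; congr (_ * (_ * \det _)).
by apply/matrixP => i j; rewrite !mxE AB // eq_sym neq_lift.
Qed.

(** * Generating functions of the strips R[p, q] *)

Definition other_direction (e : direction) : direction :=
  match e with FromLeft => FromBelow | FromBelow => FromLeft end.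

Lemma next_boxK e b : prev_box e (next_box e b) = b.
Proof.
by case: e b => -[i j]; rewrite /= /left_box /bottom_box; congr pair => /=; lia.
Qed.

Lemma prev_boxK e b : next_box e (prev_box e b) = b.
Proof.
by case: e b => -[i j]; rewrite /= /right_box /top_box; congr pair => /=; lia.
Qed.

Lemma content_next e b : content (next_box e b) = content b + 1.
Proof. by case: e b => -[i j]; rewrite /content /=; lia. Qed.

Lemma content_prev e b : content (prev_box e b) = content b - 1.
Proof. by case: e b => -[i j]; rewrite /content /=; lia. Qed.

Lemma next_box_other e b :
  next_box e (next_box (other_direction e) b) =
  next_box (other_direction e) (next_box e b).
Proof. by case: e. Qed.

Section StripSums.
Variables (K : comNzRingType) (L : finType) (right_rel : rel L).
Variables (w : int -> L -> K) (d : int -> direction).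

(** Whether the letter v may follow u in a strip, when the box of v is
    approached from the direction e. *)
Definition step_rel (e : direction) (u v : L) : bool :=
  match e with FromLeft => right_rel u v | FromBelow => ~~ right_rel u v end.

Fixpoint strip_sum_from (p : int) (k : nat) (v : L) : K :=
  match k with
  | 0%N => w p v
  | k'.+1 => w (p + k'.+1%:Z) v *
      \sum_(u | step_rel (d (p + k'.+1%:Z)) u v) strip_sum_from p k' u
  end.

(** The generating function of the fillings of R[p, c] with last letter v;
    it is 0 when p > c, so that one recurrence covers all p ([strip_sumS]). *)
Definition strip_sum (c p : int) (v : L) : K :=
  if p <= c then strip_sum_from p `|c - p|%N v else 0.

(** The generating function of all fillings of R[p, c], with the values 1
    for the empty strip and 0 for an undefined one. *)
Definition strip_total (c p : int) : K :=
  if p <= c then \sum_u strip_sum c p u else (p == c + 1)%:R.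

Lemma strip_sum_lt (c p : int) v : c < p -> strip_sum c p v = 0.
Proof. by rewrite /strip_sum leNgt => ->. Qed.

(** The last summand is the strip that starts at content c + 1. *)
Lemma strip_sumS (c p : int) v :
  strip_sum (c + 1) p v =
  w (c + 1) v * (\sum_(u | step_rel (d (c + 1)) u v) strip_sum c p u
                 + (p == c + 1)%:R).
Proof.
have [pc|cp] := leP p c.
  rewrite /strip_sum pc (_ : p <= c + 1); last by lia.
  rewrite (_ : (p == c + 1) = false) ?addr0; last by lia.
  rewrite (_ : `|(c + 1)%R - p|%N = `|c - p|%N.+1); last by lia.
  by rewrite /= (_ : p + _ = c + 1) //; lia.
rewrite big1 ?add0r => [|u _]; last exact: strip_sum_lt.
rewrite /strip_sum; case: eqP => [->|np]; first by rewrite lexx subrr mulr1.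
by rewrite mulr0; case: ifP => //; lia.
Qed.

Lemma strip_totalE (c p : int) :
  strip_total c p = \sum_u strip_sum c p u + (p == c + 1)%:R.
Proof.
rewrite /strip_total; case: leP => [pc|cp].
  by rewrite (_ : (p == c + 1) = false) ?addr0 //; lia.
by rewrite big1 ?add0r // => u _; exact: strip_sum_lt.
Qed.

End StripSums.

(** * Geometry of convex sets of boxes cut into strips *)

Definition box_le (b b' : box) : bool := (b.1 <= b'.1) && (b.2 <= b'.2).

Definition box_convex (D : {fset box}) : Prop :=
  forall b b' x : box, b \in D -> b' \in D ->
  box_le b x -> box_le x b' -> x \in D.

(** What the sweep needs to know about the strips: strip i has exactly one
    box of each content from p i to q i, each box other than the first is
    approached from the direction d, and the box that would precede the first
    one is outside D. *)
Record strip_decomposition (D : {fset box}) (d : int -> direction) (n : nat)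
    (theta : 'I_n -> {fset box}) (p q : 'I_n -> int) : Prop := {
  strip_cover : forall b : box, (b \in D) = [exists i, b \in theta i];
  strip_disjoint : forall i j (b : box),
    b \in theta i -> b \in theta j -> i = j;
  strip_le : forall i, p i <= q i;
  strip_content : forall i (b : box), b \in theta i -> p i <= content b <= q i;
  strip_box_exists : forall i c, p i <= c <= q i ->
    exists2 b : box, b \in theta i & content b = c;
  strip_box_unique : forall i (b b' : box), b \in theta i -> b' \in theta i ->
    content b = content b' -> b = b';
  strip_prev : forall i (b : box), b \in theta i -> p i < content b ->
    prev_box (d (content b)) b \in theta i;
  strip_start : forall i (b : box), b \in theta i -> content b = p i ->
    prev_box (d (content b)) b \notin D
}.

Section Geometry.
Variables (D : {fset box}) (d : int -> direction) (n : nat).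
Variables (theta : 'I_n -> {fset box}) (p q : 'I_n -> int).
Hypothesis convD : box_convex D.
Hypothesis decD : strip_decomposition D d theta p q.

Lemma strip_sub i (b : box) : b \in theta i -> b \in D.
Proof. by move=> bi; rewrite (strip_cover decD); apply/existsP; exists i. Qed.

(** The strip of the next box cannot start there, as b precedes it in D. *)
Lemma next_in_strip i (b : box) :
  b \in theta i -> next_box (d (content b + 1)) b \in D ->
  next_box (d (content b + 1)) b \in theta i.
Proof.
set b' := next_box _ _ => bi b'D; have cb' : content b' = content b + 1.
  by rewrite content_next.
have pb' : prev_box (d (content b')) b' = b by rewrite cb' next_boxK.
have := b'D; rewrite (strip_cover decD) => /existsP [k b'k].
have /andP [pk _] := strip_content decD b'k.
case: (ltgtP (p k) (content b')) pk => // [lt _|eq _].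
  have := strip_prev decD b'k lt; rewrite pb' => bk.
  by rewrite (strip_disjoint decD bi bk).
by have := strip_start decD b'k (esym eq); rewrite pb' (strip_sub bi).
Qed.

Lemma next_of_not_last i (b : box) :
  b \in theta i -> content b < q i ->
  next_box (d (content b + 1)) b \in theta i.
Proof.
move=> bi bq; have /andP [pb _] := strip_content decD bi.
have [|b' b'i cb'] := strip_box_exists decD (i := i) (c := content b + 1).
  by apply/andP; split; lia.
have pb' : p i < content b' by lia.
have := strip_prev decD b'i pb'; rewrite cb' => prevb'.
suff eb : prev_box (d (content b + 1)) b' = b.
  by rewrite -[X in next_box _ X]eb prev_boxK.
by apply: (strip_box_unique decD prevb' bi); rewrite content_prev; lia.
Qed.

(** The boxes of two consecutive diagonals form a chain, of which D contains an
    interval.  A box of content c whose neighbour outside its strip is missing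
    is one end of the interval, on the side where a strip would have to start
    on the diagonal c + 1. *)
Lemma no_start_beside_gap (b : box) j :
  b \in D -> next_box (other_direction (d (content b + 1))) b \notin D ->
  p j != content b + 1.
Proof.
move=> bD gap; apply/eqP => pj.
have [|b' b'j cb'] := strip_box_exists decD (i := j) (c := content b + 1).
  by have := strip_le decD j; lia.
have b'D := strip_sub b'j.
have := strip_start decD b'j; rewrite cb' pj => /(_ erefl).
have cb : content b' = content b + 1 by [].
case: (d _) gap => /= gap; apply/negP; rewrite negbK.
- have [le|lt] := leP b.1 b'.1.
    by apply: convD bD b'D _ _; rewrite /box_le /left_box /=;
      rewrite /content in cb; lia.
  case/negP: gap; apply: convD b'D bD _ _; rewrite /box_le /top_box /=;
    rewrite /content in cb; lia.
- have [le|lt] := leP b.1 b'.1.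
    case/negP: gap; apply: convD bD b'D _ _; rewrite /box_le /right_box /=;
      rewrite /content in cb; lia.
  by apply: convD b'D bD _ _; rewrite /box_le /bottom_box /=;
    rewrite /content in cb; lia.
Qed.

(** Of two boxes on one diagonal, the predecessor of one lies between them,
    hence in D, so they cannot both start a strip. *)
Lemma start_content_inj : injective p.
Proof.
have start i : exists2 b : box, b \in theta i & content b = p i.
  by apply: (strip_box_exists decD); rewrite lexx (strip_le decD).
(* By symmetry, the start of strip i may be taken above that of strip j. *)
suff wl i j (b b' : box) : b \in theta i -> b' \in theta j -> content b = p i ->
    content b' = p j -> p i = p j -> b.1 <= b'.1 -> i = j.
  move=> i j pij; have [b bi cb] := start i; have [b' b'j cb'] := start j.
  have [le|/ltW le] := leP b.1 b'.1; first exact: wl bi b'j cb cb' pij le.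
  by apply/esym; apply: wl b'j bi cb' cb (esym pij) le.
move=> bi b'j cb cb' pij; rewrite le_eqVlt => /orP [/eqP eq1|lt1].
  suff bb' : b = b' by apply: (strip_disjoint decD bi); rewrite bb'.
  rewrite /content in cb cb'.
  case: b b' {bi b'j} cb cb' eq1 => [x y] [x' y'] /=.
  by move=> *; congr pair; lia.
have bD := strip_sub bi; have b'D := strip_sub b'j.
have := strip_start decD bi cb; have := strip_start decD b'j cb'.
rewrite cb cb' pij; rewrite /content in cb cb'.
case: (d _) => /= [+ _ | _]; apply: contraNeq => _;
  by apply: convD bD b'D _ _; rewrite /box_le /left_box /bottom_box /=; lia.
Qed.

End Geometry.

(** * Sweeping the diagonals *)

Section Transfer.
Variables (K : comNzRingType) (L : finType) (l0 : L) (right_rel : rel L).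
Hypothesis right_rel_mono : forall u v v' t,
  right_rel v' t -> ~~ right_rel v t -> right_rel u v' -> right_rel u v.
Variables (w : int -> L -> K) (d : int -> direction).
Variables (D : {fset box}) (n : nat).
Variables (theta : 'I_n -> {fset box}) (p q : 'I_n -> int).
Hypothesis convD : box_convex D.
Hypothesis decD : strip_decomposition D d theta p q.

Local Notation filling := {ffun D -> L}.
Local Notation step := (step_rel right_rel).
Local Notation sum1 := (strip_sum right_rel w d).
Local Notation total := (strip_total right_rel w d).

Definition diagonal (x : D) : int := content (val x).

(** Only the neighbours of content one more than that of x are constrained, so
    that the conditions at the boxes of content c involve just the diagonals c
    and c + 1. *)
Definition fits (M : filling) (x : D) (v : L) : bool :=
  [forall y : D,
    ((val y == right_box (val x)) ==> right_rel v (M y)) &&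
    ((val y == top_box (val x)) ==> ~~ right_rel v (M y))].

Definition box_at (i : 'I_n) (c : int) : option D :=
  [pick x : D | (val x \in theta i) && (content (val x) == c)].

Definition strip_letter (M : filling) i c : L := oapp M l0 (box_at i c).

Definition frontier_row (c : int) (i : 'I_n) (v : L) (j : 'I_n) : K :=
  if c < p i then (i == j)%:R
  else if q i < c then total (q i) (p j)
  else sum1 c (p j) v.

(** For M locally admissible, its determinant is the generating function of the
    fillings of the boxes of content at most c with the letters of M on the
    diagonal c. *)
Definition frontier_matrix (M : filling) (c : int) : 'M[K]_n :=
  \matrix_(i < n, j < n) frontier_row c i (strip_letter M i c) j.

(** Fillings of the boxes of content at least c only, the others carrying the
    dummy letter l0 so that the type does not depend on c. *)
Definition fits_from (c : int) (M : filling) : bool :=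
  [forall x : D, if diagonal x < c then M x == l0 else fits M x (M x)].

Lemma box_at_some i c (x : D) :
  box_at i c = Some x -> val x \in theta i /\ content (val x) = c.
Proof. by rewrite /box_at; case: pickP => // y /andP [yi /eqP cy] [<-]. Qed.

Lemma box_at_eq i c (x : D) :
  val x \in theta i -> content (val x) = c -> box_at i c = Some x.
Proof.
move=> xi cx; rewrite /box_at; case: pickP => [y /andP [yi /eqP cy]|/(_ x)].
  by rewrite (val_inj (strip_box_unique decD yi xi _)) // cx cy.
by rewrite xi cx eqxx.
Qed.

Lemma box_at_alive i c : p i <= c <= q i -> exists x, box_at i c = Some x.
Proof.
move=> /(strip_box_exists decD) [b bi cb].
have bD : b \in D by exact: (strip_sub decD bi).
by exists [` bD]; apply: box_at_eq.
Qed.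

Lemma alive_of_box_at i c (x : D) : box_at i c = Some x -> p i <= c <= q i.
Proof. by move=> /box_at_some [xi <-]; exact: (strip_content decD xi). Qed.

Lemma strip_of_exists (x : D) : exists i, val x \in theta i.
Proof. by apply/existsP; rewrite -(strip_cover decD) fsvalP. Qed.

Definition strip_of (x : D) : 'I_n := xchoose (strip_of_exists x).

Lemma strip_of_mem (x : D) : val x \in theta (strip_of x).
Proof. exact: (xchooseP (strip_of_exists x)). Qed.

Lemma strip_of_eq i (x : D) : val x \in theta i -> strip_of x = i.
Proof. by move=> xi; apply: (strip_disjoint decD (strip_of_mem x) xi). Qed.

Definition neighbour (e : direction) (x : D) : option D :=
  insub (next_box e (val x)).

Lemma neighbour_some e x y :
  neighbour e x = Some y -> val y = next_box e (val x).
Proof. by rewrite /neighbour; case: insubP => // z _ <- [->]. Qed.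

Lemma neighbour_none e x :
  neighbour e x = None -> next_box e (val x) \notin D.
Proof. by rewrite /neighbour; case: insubP. Qed.

Lemma neighbour_eq e x (y : D) :
  val y = next_box e (val x) -> neighbour e x = Some y.
Proof. by rewrite /neighbour => <-; rewrite valK. Qed.

(** In terms of the direction e, the next box in the strip of x and the other
    next box play opposite roles, whatever e is. *)
Lemma fitsE e M x v :
  fits M x v =
  (if neighbour e x is Some y then step e v (M y) else true) &&
  (if neighbour (other_direction e) x is Some y then ~~ step e v (M y)
   else true).
Proof.
have one g (P : pred D) : [forall y : D, (val y == next_box g (val x)) ==> P y]
    = (if neighbour g x is Some y then P y else true).
  case E : (neighbour g x) => [y|].
    apply/forallP/idP => [/(_ y)|Py z]; first by rewrite (neighbour_some E) eqxx.
    by apply/implyP => /eqP /neighbour_eq; rewrite E => -[<-].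
  apply/forallP => z; apply/implyP => /eqP ez.
  by have := neighbour_none E; rewrite -ez (valP z).
transitivity ([forall y : D, (val y == right_box (val x)) ==> right_rel v (M y)]
  && [forall y : D, (val y == top_box (val x)) ==> ~~ right_rel v (M y)]).
  apply/forallP/andP => [H|[/forallP H1 /forallP H2] y]; last by rewrite H1 H2.
  by split; apply/forallP => y; have /andP [] := H y.
rewrite (one FromLeft (fun y => right_rel v (M y))).
rewrite (one FromBelow (fun y => ~~ right_rel v (M y))).
case: e => //=; rewrite andbC; congr (_ && _).
by case: neighbour => // y; rewrite negbK.
Qed.

Lemma strip_letter_some M i c x :
  box_at i c = Some x -> strip_letter M i c = M x.
Proof. by rewrite /strip_letter => ->. Qed.

Section Step.
Variables (c : int) (M : filling).
Hypothesis fitM : fits_from (c + 1) M.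

Local Notation e := (d (c + 1)).

(** A strip without a box on the diagonal c receives the dummy letter l0, so that
    the letters on that diagonal are indexed by all strips. *)
Definition admissible (i : 'I_n) : pred L :=
  fun v => if box_at i c is Some x then fits M x v else v == l0.

(** The rows of the matrix for c + 1, without the weights of the letters on the
    diagonal c + 1. *)
Definition unweighted_row (i j : 'I_n) : K :=
  if c + 1 < p i then (i == j)%:R
  else if q i < c + 1 then total (q i) (p j)
  else \sum_(u | step e u (strip_letter M i (c + 1))) sum1 c (p j) u
       + (p j == c + 1)%:R.

(** The row of strip k is to be subtracted from the row of strip i. *)
Definition beside (i k : 'I_n) : bool :=
  if box_at i c is Some x
  then next_box (other_direction e) (val x) \in theta k else false.

(** The position of strip i along the diagonal c + 1, actual or prolonged by one
    step, oriented so that it decreases towards the other neighbour. *)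
Definition row_height (i : 'I_n) : int :=
  let height (b : box) : int := if e is FromLeft then b.1 else - b.1 in
  if box_at i (c + 1) is Some y then height (val y)
  else if box_at i c is Some x then height (next_box e (val x)) else 0.

Lemma box_at_next i x y : box_at i c = Some x -> box_at i (c + 1) = Some y ->
  val y = next_box e (val x).
Proof.
move=> /box_at_some [xi cx] Ey; have /andP [_ qi] := alive_of_box_at Ey.
have /box_at_some [yi cy] := Ey.
have := next_of_not_last decD xi; rewrite cx => /(_ _)/wrap [|nx].
  by lia.
by apply: (strip_box_unique decD yi nx); rewrite content_next cx.
Qed.

Lemma beside_lt i k : beside i k -> row_height k < row_height i.
Proof.
rewrite /beside; case Ei : (box_at i c) => [x|//] nk.
have [xi cx] := box_at_some Ei.
have nD := strip_sub decD nk.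
have Ek : box_at k (c + 1) = Some [` nD].
  by apply: box_at_eq => //=; rewrite content_next cx.
rewrite /row_height Ek Ei /=.
have -> : (if box_at i (c + 1) is Some y
    then (let height (b : box) : int := if e is FromLeft then b.1 else - b.1 in
          height (val y))
    else (let height (b : box) : int := if e is FromLeft then b.1 else - b.1 in
          height (next_box e (val x))))
  = (if e is FromLeft then (next_box e (val x)).1 else - (next_box e (val x)).1).
  by case Ei' : (box_at i (c + 1)) => [y|//]; rewrite (box_at_next Ei Ei').
by case: e => /=; lia.
Qed.

Lemma fits_above x : c + 1 <= content (val x) -> fits M x (M x).
Proof.
by move=> cx; have /forallP /(_ x) := fitM; rewrite ltNge /diagonal cx.
Qed.

(** The two neighbours of x on the diagonal c + 1 have a common neighbour on the
    diagonal c + 2, which lies in D by convexity; the letter there separates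
    the letters of the two neighbours. *)
Lemma step_other_next x y z u :
  content (val x) = c -> neighbour e x = Some z ->
  neighbour (other_direction e) x = Some y ->
  step e u (M y) -> step e u (M z).
Proof.
move=> cx /neighbour_some ez /neighbour_some ey.
have tD : next_box e (val y) \in D.
  have := fsvalP z; have := fsvalP y; rewrite /= ez ey => yD zD.
  move: ey ez yD zD; case: e => /= ey ez yD zD;
    by [apply: convD yD zD _ _; rewrite /box_le /right_box /top_box /=; lia
       |apply: convD zD yD _ _; rewrite /box_le /right_box /top_box /=; lia].
have [t nyt nzt] : exists2 t, neighbour e y = Some t
    & neighbour (other_direction e) z = Some t.
  by exists [` tD]; apply: neighbour_eq; rewrite SubK // ez ey next_box_other.
have := fits_above (x := y); rewrite ey content_next cx lexx => /(_ isT).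
rewrite (fitsE e) nyt => /andP [yt _].
have := fits_above (x := z); rewrite ez content_next cx lexx => /(_ isT).
rewrite (fitsE e) nzt => /andP [_ zt].
move: yt zt; case: e => /= yt zt; first exact: right_rel_mono yt zt.
by apply: contra; apply: right_rel_mono yt; move: zt; rewrite negbK.
Qed.

Lemma unweighted_row_some i j z : box_at i (c + 1) = Some z ->
  unweighted_row i j =
  \sum_(u | step e u (M z)) sum1 c (p j) u + (p j == c + 1)%:R.
Proof.
move=> Ei; have /andP [pi qi] := alive_of_box_at Ei.
by rewrite /unweighted_row !ltNge pi qi /= (strip_letter_some M Ei).
Qed.

(** The letters that may precede the other neighbour form a subset of those that
    may precede the next box, and the difference is the set of letters that fit
    at x.  The terms for a strip starting at c + 1 cancel, or are absent
    because there is no other neighbour. *)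
Lemma row_minus_beside i j : p i != c + 1 ->
  unweighted_row i j - \sum_k (beside i k)%:R * unweighted_row k j =
  \sum_(v | admissible i v) frontier_row c i v j.
Proof.
move=> pi1; rewrite /admissible /beside.
case Ei : (box_at i c) => [x|]; last first.
  rewrite big1 ?subr0 => [|k _]; last by rewrite mul0r.
  rewrite big_pred1_eq /unweighted_row /frontier_row.
  have [cp|pc] := ltP c (p i); first by rewrite (_ : c + 1 < p i) //; lia.
  have qc : q i < c.
    rewrite ltNge; apply/negP => cq.
    by have [|x] := box_at_alive (i := i) (c := c); rewrite ?pc ?cq ?Ei.
  rewrite (_ : (c + 1 < p i) = false); last by lia.
  by rewrite (_ : q i < c + 1) ?qc //; lia.
have [xi cx] := box_at_some Ei; have /andP [pi qi] := alive_of_box_at Ei.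
pose f u := sum1 c (p j) u.
pose linked u := if neighbour e x is Some y then step e u (M y) else true.
pose crossed u :=
  if neighbour (other_direction e) x is Some y then step e u (M y) else false.
have rowi : unweighted_row i j = \sum_(u | linked u) f u + (p j == c + 1)%:R.
  rewrite /linked; case En : (neighbour e x) => [z|].
    have nz := neighbour_some En.
    apply: unweighted_row_some; apply: box_at_eq; last first.
      by rewrite nz content_next cx.
    have := fsvalP z; rewrite /= nz -cx; exact: (next_in_strip decD xi).
  (* Without a next box the strip ends at c, and its row becomes final. *)
  have qic : q i = c.
    apply/eqP; rewrite eq_le qi andbT leNgt; apply/negP => cq.
    have := neighbour_none En; rewrite -cx (strip_sub decD (i := i)) //.
    by apply: (next_of_not_last decD xi); rewrite cx.
  rewrite /unweighted_row qic (_ : (c + 1 < p i) = false); last by lia.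
  by rewrite (_ : c < c + 1) ?strip_totalE //; lia.
have rowk : \sum_k (next_box (other_direction e) (val x) \in theta k)%:R *
      unweighted_row k j
    = \sum_(u | crossed u) f u + (p j == c + 1)%:R.
  rewrite /crossed; case En : (neighbour (other_direction e) x) => [y|].
    have ny := neighbour_some En.
    have yk := strip_of_mem y; rewrite -ny.
    rewrite (bigD1 (strip_of y)) //= yk mul1r big1 ?addr0 => [|k nk].
      by apply: unweighted_row_some; apply: box_at_eq; rewrite // ny content_next cx.
    case: (boolP (_ \in _)) => [yk'|_]; last by rewrite mul0r.
    by rewrite (strip_of_eq yk') eqxx in nk.
  have gap := neighbour_none En.
  have := no_start_beside_gap convD decD (b := val x) j (fsvalP x).
  rewrite cx => /(_ gap) /negPf ->; rewrite big_pred0_eq add0r.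
  rewrite big1 // => k _; case: (boolP (_ \in _)) => [xk|_]; last by rewrite mul0r.
  by rewrite (strip_sub decD xk) in gap.
rewrite rowk rowi [X in _ - X]addrC addrKA (bigID crossed) /=.
rewrite [X in X + _ - _](_ : _ = \sum_(u | crossed u) f u); last first.
  apply: eq_bigl => u; rewrite andbC; case: (boolP (crossed u)) => //=.
  rewrite /crossed /linked; case Ey : (neighbour (other_direction e) x) => [y|//].
  case Ez : (neighbour e x) => [z|//]; exact: step_other_next cx Ez Ey.
(* What remains are the letters that fit at x, by [fitsE]. *)
rewrite addrC addKr; apply: eq_big => [u|u _].
  by rewrite (fitsE e) /linked /crossed; case: (neighbour (other_direction e) x).
by rewrite /frontier_row !ltNge pi qi.
Qed.

(** The row reduction gives the left-hand matrix except in the row of the strip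
    that starts at c + 1, if there is one.  There it leaves a sum of rows for
    the diagonal c besides the unit vector; but the column of that strip
    vanishes outside its diagonal entry, so only this entry matters. *)
Lemma det_unweighted :
  \det (\matrix_(i < n, j < n) \sum_(v | admissible i v) frontier_row c i v j) =
  \det (\matrix_(i < n, j < n) unweighted_row i j).
Proof.
pose U : 'M[K]_n := \matrix_(i < n, k < n) ((i == k)%:R - (beside i k)%:R).
pose C : 'M[K]_n := \matrix_(i < n, j < n) unweighted_row i j.
have UC i j : (U *m C) i j =
    unweighted_row i j - \sum_k (beside i k)%:R * unweighted_row k j.
  rewrite mxE; under eq_bigr do rewrite !mxE mulrBl.
  rewrite sumrB (bigD1 i) //= eqxx mul1r big1 ?addr0 // => k ki.
  by rewrite eq_sym (negPf ki) mul0r.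
rewrite -/C -[RHS]mul1r -(det_one_minus_decreasing K beside_lt) -det_mulmx -/U.
(* The strip k starting at c + 1, if any, is unique. *)
have [k /eqP pk|nostart] := pickP (fun k => p k == c + 1); last first.
  congr (\det _); apply/matrixP => i j; rewrite UC mxE row_minus_beside //.
  by rewrite nostart.
have pE i : (p i == c + 1) = (i == k).
  by rewrite -pk (inj_eq (start_content_inj convD decD)).
have started i : box_at i c = None \/ p i <= c.
  by case E : (box_at i c) => [x|]; [right; have /andP [] := alive_of_box_at E|left].
have Ek : box_at k c = None by case: (started k) => //; lia.
apply: (det_eq_off_row (k := k)) => [i j ik||i ik].
- by rewrite UC mxE row_minus_beside // pE.
- rewrite UC mxE /admissible /beside Ek big_pred1_eq /frontier_row pk.
  rewrite (_ : c < c + 1) ?eqxx; last by lia.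
  rewrite [X in _ - X]big1 ?subr0 => [|l _]; last by rewrite mul0r.
  have [|y Ey] := box_at_alive (i := k) (c := c + 1).
    by have := strip_le decD k; lia.
  rewrite (unweighted_row_some k Ey) pk eqxx big1 ?add0r // => u _.
  by apply: strip_sum_lt; lia.
- rewrite mxE; apply: big1 => u _; rewrite /frontier_row (negPf ik).
  case: ifP => // _; case: ifP => [qi|_]; last by apply: strip_sum_lt; lia.
  rewrite strip_totalE pk big1 => [|v _]; last by apply: strip_sum_lt; lia.
  by rewrite (_ : (c + 1 == q i + 1) = false) ?addr0 //; lia.
Qed.

Lemma det_frontier_step :
  \det (frontier_matrix M (c + 1)) =
  (\prod_(x : D | diagonal x == c + 1) w (c + 1) (M x)) *
  \det (\matrix_(i < n, j < n) \sum_(v | admissible i v) frontier_row c i v j).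
Proof.
pose W i := if box_at i (c + 1) is Some y then w (c + 1) (M y) else 1.
have -> : \prod_(x : D | diagonal x == c + 1) w (c + 1) (M x) = \prod_i W i.
  rewrite (partition_big strip_of xpredT) //=; apply: eq_bigr => i _.
  rewrite /W; case E : (box_at i (c + 1)) => [y|].
    have [yi cy] := box_at_some E; apply: big_pred1 => x.
    apply/andP/eqP => [[/eqP cx /eqP xi]|->]; last first.
      by rewrite /diagonal cy eqxx (strip_of_eq yi).
    have := strip_of_mem x; rewrite xi => xi'.
    by have := box_at_eq xi' cx; rewrite E => -[].
  apply: big_pred0 => x; apply/negP => /andP [/eqP cx /eqP xi].
  by have := strip_of_mem x; rewrite xi => /box_at_eq /(_ cx); rewrite E.
rewrite det_unweighted.
have -> : frontier_matrix M (c + 1) =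
    diag_mx (\row_i W i) *m \matrix_(i < n, j < n) unweighted_row i j.
  apply/matrixP => i j; rewrite mul_diag_mx !mxE /frontier_row /unweighted_row /W.
  case E : (box_at i (c + 1)) => [y|].
    have /andP [pi qi] := alive_of_box_at E.
    by rewrite !ltNge pi qi /= (strip_letter_some M E) strip_sumS.
  rewrite mul1r; case: ifP => // /negbT; rewrite -leNgt => pi.
  case: ifP => // /negbT; rewrite -leNgt => qi.
  by have [|x] := box_at_alive (i := i) (c := c + 1); rewrite ?pi ?qi ?E.
by rewrite det_mulmx det_diag; congr (_ * _); apply: eq_bigr => i _; rewrite mxE.
Qed.

End Step.

Lemma eq_fits (M M' : filling) x v :
  (forall y, diagonal y = diagonal x + 1 -> M y = M' y) ->
  fits M x v = fits M' x v.
Proof.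
move=> eqM; have nb y g : val y = next_box g (val x) -> M y = M' y.
  by move=> ey; apply: eqM; rewrite /diagonal ey content_next.
apply: eq_forallb => y; congr (_ && _).
  by case: eqP => //= /(nb y FromLeft) ->.
by case: eqP => //= /(nb y FromBelow) ->.
Qed.

Definition erase (c : int) (M : filling) : filling :=
  [ffun x => if diagonal x == c then l0 else M x].

Lemma fits_from_erase c M : fits_from c M -> fits_from (c + 1) (erase c M).
Proof.
move=> /forallP fitM; apply/forallP => x; have := fitM x.
have [xc|cx] := ltP (diagonal x) c => fx.
  rewrite (_ : diagonal _ < c + 1) ?ffunE; last by lia.
  by case: ifP.
have [xc|xc] := ltP (diagonal x) (c + 1).
  by rewrite ffunE (_ : diagonal _ == c) //; lia.
rewrite ffunE (_ : (_ == c) = false); last by lia.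
rewrite (eq_fits (M' := M)) // => y cy; rewrite ffunE.
by rewrite (_ : (_ == c) = false) //; lia.
Qed.

(** A filling that restricts to M' above content c amounts to one admissible
    letter for each strip alive at c. *)
Lemma sum_over_diagonal c M' : fits_from (c + 1) M' ->
  \sum_(M | fits_from c M && (erase c M == M')) \det (frontier_matrix M c) =
  \sum_(u in family (admissible c M'))
    \det (\matrix_(i < n, j < n) frontier_row c i (u i) j).
Proof.
move=> fitM'.
pose glue (u : {ffun 'I_n -> L}) : filling :=
  [ffun x => if diagonal x == c then u (strip_of x) else M' x].
pose diag (M : filling) : {ffun 'I_n -> L} := [ffun i => strip_letter M i c].
rewrite (reindex_onto glue diag) => [|M /andP [_ /eqP eM]]; last first.
  apply/ffunP => x; rewrite ffunE -eM !ffunE; case: eqP => // cx.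
  by rewrite (strip_letter_some M (box_at_eq (strip_of_mem x) cx)).
have glue_at u i x : box_at i c = Some x -> glue u x = u i.
  move=> /box_at_some [xi cx].
  by rewrite ffunE (_ : diagonal x = c) // eqxx (strip_of_eq xi).
have glue_above u y : c < diagonal y -> glue u y = M' y.
  by move=> cy; rewrite ffunE (_ : (_ == c) = false) //; lia.
have fits_glue u x v : c <= diagonal x -> fits (glue u) x v = fits M' x v.
  by move=> cx; apply: eq_fits => y cy; apply: glue_above; lia.
apply: eq_big => [u|u /andP [_ /eqP du]]; last first.
  congr (\det _); apply/matrixP => i j; rewrite !mxE; congr (frontier_row c i _ j).
  by rewrite -[in RHS]du ffunE.
apply/idP/familyP => [/andP [/andP [/forallP fitu _] /eqP du] i|adm].
  rewrite unfold_in /admissible; case E : (box_at i c) => [x|]; last first.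
    by rewrite -du ffunE /strip_letter E.
  have cx : diagonal x = c by have [] := box_at_some E.
  have := fitu x.
  by rewrite cx ltxx (glue_at _ _ _ E) fits_glue ?cx.
have {}adm i : admissible c M' i (u i) by exact: adm.
have M'x x : diagonal x <= c -> M' x = l0.
  move=> xc; have /forallP /(_ x) := fitM'.
  by rewrite (_ : diagonal _ < c + 1) => [/eqP|]; last by lia.
apply/andP; split; last first.
  apply/eqP/ffunP => i; rewrite ffunE /strip_letter.
  have := adm i; rewrite /admissible.
  by case E : (box_at i c) => [x|] /=; [rewrite (glue_at _ _ _ E)|move/eqP].
apply/andP; split; last first.
  apply/eqP/ffunP => x; rewrite !ffunE; case: eqP => // cx.
  by rewrite M'x ?cx.
apply/forallP => x; case: ltP => [xc|].
  by rewrite ffunE (_ : (_ == c) = false) ?M'x //; lia.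
rewrite le_eqVlt => /orP [/eqP cx|cx].
  have E := box_at_eq (strip_of_mem x) (esym cx).
  have := adm (strip_of x); rewrite /admissible E (glue_at _ _ _ E).
  by rewrite fits_glue -?cx.
rewrite glue_above // fits_glue; last by lia.
have /forallP /(_ x) := fitM'.
by rewrite (_ : (diagonal _ < c + 1) = false) //; lia.
Qed.

Definition partial_sum (c : int) : K :=
  \sum_(M : filling | fits_from c M)
    (\prod_(x : D | c < diagonal x) w (diagonal x) (M x)) *
    \det (frontier_matrix M c).

(** Fillings for c are grouped by their restriction to contents above c. *)
Lemma partial_sumS c : partial_sum c = partial_sum (c + 1).
Proof.
rewrite /partial_sum (partition_big (erase c) (fits_from (c + 1))); last first.
  by move=> M; apply: fits_from_erase.
apply: eq_bigr => M' fitM'; rewrite det_frontier_step // det_family_sum.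
rewrite -sum_over_diagonal // mulrA big_distrr /=.
apply: eq_bigr => M /andP [_ /eqP eM]; congr (_ * _).
rewrite mulrC (bigID (fun x : D => diagonal x == c + 1)) /=; congr (_ * _).
  apply: eq_big => [x|x /andP [cx /eqP ->]]; first by lia.
  by rewrite -eM ffunE (_ : (_ == c) = false) //; lia.
apply: eq_big => [x|x /andP [cx _]]; first by lia.
by rewrite -eM ffunE (_ : (_ == c) = false) //; lia.
Qed.

(** The invariant [partial_sum] is evaluated below and above all contents. *)
Theorem sum_fillings_det :
  \sum_(M : filling | [forall x, fits M x (M x)])
     \prod_(x : D) w (diagonal x) (M x) =
  \det (\matrix_(i < n, j < n) total (q i) (p j)).
Proof.
(* Every content lies strictly between - B and B. *)
pose B : nat := (\sum_(x : D) `|diagonal x|%N).+1.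
have boundB (x : D) : - B%:Z < diagonal x < B%:Z.
  by rewrite /B (bigD1 x) //=; lia.
have bound c i : p i <= c <= q i -> - B%:Z < c < B%:Z.
  move=> /(strip_box_exists decD) [b bi <-].
  exact: (boundB [` strip_sub decD bi]).
have boundp i : - B%:Z < p i.
  have pq := strip_le decD i; have : p i <= p i <= q i by rewrite lexx.
  by move=> /bound /andP [].
have boundq i : q i < B%:Z.
  have pq := strip_le decD i; have : p i <= q i <= q i by rewrite lexx pq.
  by move=> /bound /andP [].
have shift k : partial_sum (- B%:Z) = partial_sum (- B%:Z + k%:Z).
  elim: k => [|k IHk]; first by rewrite addr0.
  by rewrite IHk partial_sumS; congr partial_sum; lia.
transitivity (partial_sum (- B%:Z)).
  apply: eq_big => [M|M _].
    by apply: eq_forallb => x; rewrite ltNge ltW //; have /andP [] := boundB x.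
  rewrite (_ : frontier_matrix M _ = 1%:M) ?det1 ?mulr1.
    by apply: eq_bigl => x; have /andP [-> _] := boundB x.
  by apply/matrixP => i j; rewrite !mxE /frontier_row boundp.
have -> : partial_sum (- B%:Z) = partial_sum B.
  by rewrite (shift (2 * B)%N); congr partial_sum; lia.
rewrite /partial_sum (big_pred1 [ffun _ => l0]) => [|M]; last first.
  have xB x : diagonal x < B by have /andP [] := boundB x.
  apply/forallP/eqP => [fitM|-> x]; last by rewrite xB ffunE.
  by apply/ffunP => x; have := fitM x; rewrite xB ffunE => /eqP.
rewrite big_pred0 ?mul1r => [|x]; last first.
  by apply/negbTE; rewrite -leNgt ltW //; have /andP [] := boundB x.
congr (\det _); apply/matrixP => i j; rewrite !mxE /frontier_row boundq.
have pq := strip_le decD i.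
by rewrite ltNge (le_trans pq) // ltW.
Qed.

End Transfer.

(** * The alphabet, and so-tableaux as local conditions *)

Section Letters.
Variable N : nat.

Definition letter_rank (v : letter N) : nat :=
  if v is Some (k, b) then (k.*2 + b)%N else N.*2.

Lemma letter_rank_le v : (letter_rank v <= N.*2)%N.
Proof. by case: v => [[k b]|] //=; have := ltn_ord k; case: b; lia. Qed.

Lemma letter_rank_None v : (v == None) = (letter_rank v == N.*2).
Proof.
case: v => [[k b]|]; last by rewrite !eqxx.
by apply/esym/negbTE => /=; have := ltn_ord k; case: b; lia.
Qed.

Lemma letter_ltE u v : letter_lt u v = (letter_rank u < letter_rank v)%N.
Proof.
case: u v => [[k b]|] [[l b']|] //=; last by rewrite ltnn.
- rewrite -[k == l]/(nat_of_ord k == nat_of_ord l); case: b b' => -[] /=; lia.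
- by have := ltn_ord k; case: b; lia.
- by have := ltn_ord l; case: b'; lia.
Qed.

Lemma letter_rank_inj : injective letter_rank.
Proof.
move=> u v uv; have: ~~ letter_lt u v && ~~ letter_lt v u.
  by rewrite !letter_ltE uv ltnn.
case: u v {uv} => [[k b]|] [[l b']|] //=.
rewrite -[k == l]/(nat_of_ord k == nat_of_ord l).
rewrite -[l == k]/(nat_of_ord l == nat_of_ord k) => H.
suff [-> /val_inj ->] : b = b' /\ nat_of_ord k = nat_of_ord l by [].
by move: H; case: b b' => -[] /=; lia.
Qed.

Lemma letter_leE u v : letter_le u v = (letter_rank u <= letter_rank v)%N.
Proof.
by rewrite /letter_le letter_ltE -(inj_eq letter_rank_inj) [RHS]leq_eqVlt.
Qed.

(** Requiring u != oo accounts for the rule that oo does not repeat along a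
    row. *)
Definition letter_right (u v : letter N) : bool := letter_le u v && (u != None).

Lemma letter_rightE u v :
  letter_right u v = (letter_rank u <= letter_rank v)%N && (letter_rank u < N.*2)%N.
Proof.
rewrite /letter_right letter_leE letter_rank_None.
by have := letter_rank_le u; lia.
Qed.

(** If t may stand right of v' but not right of v, then v' is smaller than v. *)
Lemma letter_right_mono u v v' t :
  letter_right v' t -> ~~ letter_right v t -> letter_right u v' ->
  letter_right u v.
Proof. by rewrite !letter_rightE; lia. Qed.

Lemma letter_right_trans u v t :
  letter_right u v -> letter_right v t -> letter_right u t.
Proof. by rewrite !letter_rightE; lia. Qed.

(** Standing above is the complement of [letter_right]: v < u, or u = v = oo;
    hence it is transitive too. *)
Lemma letter_above_trans u v t :
  ~~ letter_right u v -> ~~ letter_right v t -> ~~ letter_right u t.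
Proof. by rewrite !letter_rightE; have := letter_rank_le u; lia. Qed.

Section LocalTableaux.
Variables (E : {fset box}) (M : {ffun E -> letter N}).
Hypothesis convE : box_convex E.

Lemma fits_row (k : nat) (x y : E) :
  [forall x, fits letter_right M x (M x)] ->
  (val y : box) = ((val x).1, (val x).2 + k.+1%:Z) -> letter_right (M x) (M y).
Proof.
move=> /forallP fitM; elim: k y => [|k IHk] y ey.
  have /forallP /(_ y) /andP [+ _] := fitM x.
  by rewrite ey eqxx.
have zE : ((val x).1, (val x).2 + k.+1%:Z) \in E.
  apply: convE (fsvalP x) (fsvalP y) _ _; rewrite /box_le /=.
    by rewrite lexx lerDl.
  by have -> : fsval y = _ := ey; rewrite /= lexx lerD2l; lia.
apply: letter_right_trans (IHk [` zE] erefl) _.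
have /forallP /(_ y) /andP [+ _] := fitM [` zE].
rewrite (_ : val y == _) // ey /right_box /=.
by apply/eqP; congr pair; rewrite -addrA; congr (_ + _); lia.
Qed.

Lemma fits_column (k : nat) (x y : E) :
  [forall x, fits letter_right M x (M x)] ->
  (val y : box) = ((val x).1 - k.+1%:Z, (val x).2) -> ~~ letter_right (M x) (M y).
Proof.
move=> /forallP fitM; elim: k y => [|k IHk] y ey.
  have /forallP /(_ y) /andP [_ +] := fitM x.
  by rewrite ey eqxx.
have zE : ((val x).1 - k.+1%:Z, (val x).2) \in E.
  apply: convE (fsvalP y) (fsvalP x) _ _; rewrite /box_le /=.
    by have -> : fsval y = _ := ey; rewrite /= lexx lerD2l lerN2; lia.
  by rewrite lexx gerBl.
apply: letter_above_trans (IHk [` zE] erefl) _.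
have /forallP /(_ y) /andP [_ +] := fitM [` zE].
rewrite (_ : val y == _) // ey /top_box /=.
by apply/eqP; congr pair; rewrite -addrA; congr (_ + _); lia.
Qed.

(** Both relations between adjacent boxes are transitive, and convexity provides
    the boxes between two boxes of a row or of a column. *)
Lemma so_tableauE :
  so_tableau M = [forall x, fits letter_right M x (M x)] && so3 M.
Proof.
apply/and4P/andP => [[/forallP M1 /forallP M2 M3 /forallP M4]|[fitM M3]].
  split => //; apply/forallP => x; apply/forallP => y; apply/andP.
  split; apply/implyP => /eqP ey.
    have e1 : (val x).1 = (val y).1 by rewrite ey.
    have lt : (val x).2 < (val y).2 by rewrite ey /= ltrDl.
    have /forallP /(_ y) := M1 x; rewrite e1 eqxx lt /= => xy.
    rewrite /letter_right xy /=; apply/negP => /eqP xN.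
    have yN : M y == None.
      move: xy; rewrite letter_leE letter_rank_None xN /=.
      by have := letter_rank_le (M y); lia.
    have /forallP /(_ y) := M4 x; rewrite e1 eqxx xN yN /= => /eqP xy'.
    by move: lt; rewrite xy' ltxx.
  have e1 : (val y).2 = (val x).2 by rewrite ey.
  have lt : (val y).1 < (val x).1 by rewrite ey /= gtrBl.
  have /forallP /(_ x) := M2 y; rewrite e1 eqxx lt /=.
  rewrite letter_ltE !letter_rank_None letter_rightE; lia.
have right (x y : E) : (val x).1 = (val y).1 -> (val x).2 < (val y).2 ->
    letter_right (M x) (M y).
  move=> e1 lt; apply: (fits_row (k := `|(val y).2 - (val x).2|.-1)) => //.
  case: (val x) (val y) e1 lt => [x1 x2] [y1 y2] /= -> lt; congr pair; lia.
split=> //.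
- apply/forallP => x; apply/forallP => y; apply/implyP => /andP [/eqP e1 lt].
  by have /andP [] := right x y e1 lt.
- apply/forallP => x; apply/forallP => y; apply/implyP => /andP [/eqP e1 lt].
  have := @fits_column (`|(val y).1 - (val x).1|.-1)%N y x fitM.
  rewrite letter_rightE letter_ltE !letter_rank_None.
  have rx := letter_rank_le (M x); have ry := letter_rank_le (M y).
  suff e : val x = ((val y).1 - (`|(val y).1 - (val x).1|.-1)%N.+1%:Z, (val y).2).
    by move/(_ e); lia.
  case: (val x) (val y) e1 lt => [x1 x2] [y1 y2] /= -> lt; congr pair; lia.
- apply/forallP => x; apply/forallP => y; apply/implyP => /and3P [/eqP e1 xN yN].
  have [lt|lt|e2] := ltgtP (val x).2 (val y).2.
  + by have /andP [_] := right x y e1 lt; rewrite xN.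
  + by have /andP [_] := right y x (esym e1) lt; rewrite yN.
  apply/eqP/val_inj; case: (val x) (val y) e1 e2 => [? ?] [? ?] /= -> -> //.
Qed.

End LocalTableaux.
End Letters.

(** * Orthogonal quasi-symmetric functions of convex sets *)

Section SoFunctions.
Variables (R : realType) (N : nat) (a : int -> R[i]).

(** The lower bound on entries of nonpositive content is encoded as a vanishing
    weight, since it involves only the content and the letter. *)
Definition so_weight (c : int) (v : letter N) : R[i] :=
  if (c <= 0) ==> letter_ge_num v `|c|%N.+1
  then cpow (letter_abs R v) (a c) else 0.

Lemma so_funE (E : {fset box}) (s : box -> R[i]) :
  box_convex E -> (forall b, b \in E -> s b = a (content b)) ->
  so_fun N E s =
  \sum_(M : {ffun E -> letter N} | [forall x, fits (@letter_right N) M x (M x)])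
     \prod_(x : E) so_weight (content (val x)) (M x).
Proof.
move=> convE sE; rewrite /so_fun (eq_bigl _ _ (fun M => so_tableauE M convE)).
rewrite big_mkcondr /=; apply: eq_bigr => M _.
rewrite /so3; case: forallP => [M3|nM3].
  by apply: eq_bigr => x _; rewrite /so_weight M3 sE ?fsvalP.
have [x /negPf nx] : exists x, ~~ ((content (val x) <= 0) ==>
    letter_ge_num (M x) `|content (val x)|%N.+1).
  by apply/existsP; rewrite -negb_forall; apply/forallP.
by rewrite (bigD1 x) //= /so_weight nx mul0r.
Qed.

Lemma so_fun_det (E : {fset box}) (s : box -> R[i]) (d : int -> direction)
    (n : nat) (theta : 'I_n -> {fset box}) (p q : 'I_n -> int) :
  box_convex E -> strip_decomposition E d theta p q ->
  (forall b, b \in E -> s b = a (content b)) ->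
  so_fun N E s =
  \det (\matrix_(i < n, j < n)
    strip_total (@letter_right N) so_weight d (q i) (p j)).
Proof.
move=> convE decE sE; rewrite (so_funE convE sE).
by rewrite (sum_fillings_det None (@letter_right_mono N) so_weight convE decE).
Qed.

End SoFunctions.

Section ContentStrip.
Variables (d : int -> direction) (p q : int).

Lemma content_strip_box k : content (strip_box d p k) = p + k%:Z.
Proof.
elim: k => [|k IHk] /=; first by rewrite /content /=; lia.
by rewrite content_next IHk; lia.
Qed.

Lemma strip_box_monotone k l : (k <= l)%N ->
  (strip_box d p l).1 <= (strip_box d p k).1 /\
  (strip_box d p k).2 <= (strip_box d p l).2.
Proof.
elim: l => [|l IHl]; first by rewrite leqn0 => /eqP ->.
rewrite leq_eqVlt => /orP [/eqP -> //|/IHl [H1 H2]] /=.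
by case: (d _) => /=; split; lia.
Qed.

Hypothesis pq : p <= q.

Lemma mem_content_strip b :
  reflect (p <= content b <= q /\ b = strip_box d p `|content b - p|)
          (b \in content_strip d p q).
Proof.
rewrite /content_strip.
apply: (iffP (imfsetP _ _ _ _)) => [[k /= kq ->]|[/andP [pb bq] eb]].
  have {}kq : (k < `|q - p|.+1)%N.
    by have : k \in iota 0 `|q - p|.+1 := kq; rewrite mem_iota.
  rewrite content_strip_box.
  by split; [lia | congr strip_box; lia].
exists `|content b - p|%N => //=.
suff: `|content b - p|%N \in iota 0 `|q - p|.+1 by [].
by rewrite mem_iota; lia.
Qed.

(** Along the strip rows weakly decrease and columns weakly increase, so two
    comparable boxes share a row or a column, as does any box between them. *)
Lemma content_strip_convex : box_convex (content_strip d p q).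
Proof.
move=> b b' x /mem_content_strip [cb eb] /mem_content_strip [cb' eb'].
rewrite /box_le => /andP [bx1 bx2] /andP [xb1 xb2].
have box_eq (y z : box) : content y = content z ->
    y.1 = z.1 \/ y.2 = z.2 -> y = z.
  by rewrite /content; case: y z => [? ?] [? ?] /= *; congr pair; lia.
(* Contents order the boxes of the strip. *)
have mono (y z : box) : p <= content y -> content y <= content z ->
    y = strip_box d p `|content y - p| -> z = strip_box d p `|content z - p| ->
    z.1 <= y.1 /\ y.2 <= z.2.
  move=> py yz -> ->; apply: strip_box_monotone; lia.
have cx : p <= content x <= q.
  have [le|/ltW le] := leP (content b) (content b').
    by have := mono b b' _ le eb eb'; move: le cb cb'; rewrite /content; lia.
  by have := mono b' b _ le eb' eb; move: le cb cb'; rewrite /content; lia.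
apply/mem_content_strip; split => //.
set y := strip_box _ _ _.
have cy : content y = content x by rewrite content_strip_box; lia.
have ey : y = strip_box d p `|content y - p| by rewrite cy.
apply: box_eq => //; move: cy.
have [le|/ltW le] := leP (content b) (content b').
  have := mono b b' _ le eb eb'; have := mono b y _ _ eb ey.
  have := mono y b' _ _ ey eb'; move: le cb cb' cx; rewrite /content; lia.
have := mono b' b _ le eb' eb; have := mono b' y _ _ eb' ey.
have := mono y b _ _ ey eb; move: le cb cb' cx; rewrite /content; lia.
Qed.

(** The strip R[p, q] is its own decomposition, which turns the general formula
    into the evaluation of a 1 by 1 determinant. *)
Lemma content_strip_decomposition :
  strip_decomposition (content_strip d p q) d
    (fun _ : 'I_1 => content_strip d p q) (fun=> p) (fun=> q).
Proof.
split=> //.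
- by move=> b; apply/idP/existsP => [bE|[]]; first by exists ord0.
- by move=> i j b _ _; rewrite !ord1.
- by move=> _ b /mem_content_strip [].
- move=> _ c cpq; have cE : content (strip_box d p `|c - p|) = c.
    by rewrite content_strip_box; lia.
  by exists (strip_box d p `|c - p|) => //; apply/mem_content_strip; rewrite cE.
- by move=> _ b b' /mem_content_strip [_ eb] /mem_content_strip [_ eb'] e;
    rewrite eb eb' e.
- move=> _ b /mem_content_strip [cb eb] pb; apply/mem_content_strip.
  rewrite content_prev; split; first by lia.
  rewrite {2}eb (_ : `|content b - p|%N = `|(content b - 1)%R - p|%N.+1) /=; last lia.
  by rewrite [X in prev_box _ (next_box (d X) _)](_ : _ = content b) ?next_boxK //; lia.
- move=> _ b _ pb; apply/negP => /mem_content_strip [].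
  by rewrite content_prev; lia.
Qed.

Lemma content_strip_neq0 : content_strip d p q != fset0.
Proof.
apply/fset0Pn; exists (strip_box d p 0); apply/mem_content_strip.
by rewrite content_strip_box; split; [lia | congr strip_box; lia].
Qed.

End ContentStrip.

Lemma mem_diagram (l : seq nat) (b : box) :
  (b \in diagram l) =
  [&& 0 < b.1, 0 < b.2 & b.2 <= (nth 0%N l `|b.1|.-1)%:Z].
Proof.
apply/imfset2P/and3P => [[i /= +] [j /= +] ->|[b1 b2 bl]] /=.
  by rewrite !mem_iota => il jl; split; lia.
have sl : (`|b.1|.-1 < size l)%N.
  by rewrite ltnNge; apply/negP => /(nth_default 0%N); lia.
exists `|b.1|%N; first by rewrite mem_iota; lia.
exists `|b.2|%N; first by rewrite mem_iota; lia.
by case: b b1 b2 {bl sl} => x y /= *; congr pair; lia.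
Qed.

Lemma diagram_lower (l : seq nat) (b b' : box) :
  is_partition l -> 0 < b.1 -> 0 < b.2 -> box_le b b' ->
  b' \in diagram l -> b \in diagram l.
Proof.
move=> /andP [sl _] b1 b2 /andP [le1 le2]; rewrite !mem_diagram b1 b2 /=.
move=> /and3P [_ _ bl]; apply: (le_trans le2); apply: (le_trans bl).
rewrite lez_nat; have [kl|/(nth_default 0%N) -> //] := ltnP `|b'.1|.-1 (size l).
have geq_trans : transitive geq by move=> x y z /= yx xz; apply: leq_trans xz yx.
apply: (sorted_leq_nth geq_trans leqnn 0%N sl) => //; rewrite ?inE; lia.
Qed.

Lemma skew_diagram_convex (l m : seq nat) :
  is_partition l -> is_partition m -> box_convex (skew_diagram l m).
Proof.
move=> pl pm b b' x; rewrite !in_fsetD => /andP [bm bl] /andP [_ b'l] bx xb'.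
have /and3P [b1 b2 _] : [&& 0 < b.1, 0 < b.2 & b.2 <= (nth 0%N l `|b.1|.-1)%:Z].
  by rewrite -mem_diagram.
have x1 : 0 < x.1 by have /andP [+ _] := bx; apply: lt_le_trans.
have x2 : 0 < x.2 by have /andP [_] := bx; apply: lt_le_trans.
rewrite (diagram_lower pl x1 x2 xb' b'l) andbT.
by apply: contra bm; apply: diagram_lower.
Qed.

Lemma strip_convex (E : {fset box}) : is_strip E -> box_convex E.
Proof. by case=> _ [l [m [pl pm _ ->]]] _ _; apply: skew_diagram_convex. Qed.

(** Two boxes of a convex set on one diagonal would span a 2 by 2 block. *)
Lemma strip_unique_content (E : {fset box}) (b b' : box) :
  is_strip E -> b \in E -> b' \in E -> content b = content b' -> b = b'.
Proof.
move=> sE; wlog le : b b' / b.1 <= b'.1.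
  move=> H bE b'E cb; have [le|/ltW le] := leP b.1 b'.1; first exact: H.
  by apply/esym; apply: H.
move=> bE b'E; rewrite /content => cb.
move: le; rewrite le_eqVlt => /orP [/eqP e|lt].
  by case: b b' e cb {bE b'E} => [? ?] [? ?] /= *; congr pair; lia.
have conv := strip_convex sE; case: sE => _ _ _ /(_ b) [].
by split=> //; apply: conv bE b'E _ _; rewrite /box_le /=; lia.
Qed.

(** Boxes of every intermediate content are found by walking back from the
    ending box, since each box but the starting one has a predecessor. *)
Lemma outside_strip_decomposition (D : {fset box}) (n : nat)
    (theta : 'I_n -> {fset box}) (start fin : 'I_n -> box)
    (d : int -> direction) :
  outside_decomposition D theta ->
  (forall i, is_starting_box (theta i) (start i)) ->
  (forall i, is_ending_box (theta i) (fin i)) ->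
  compatible_directions D theta d ->
  strip_decomposition D d theta (fun i => content (start i))
    (fun i => content (fin i)).
Proof.
move=> [strips disj cover _ _] starts ends [dprev dstart].
have extreme i (c b : box) : is_starting_box (theta i) c -> b \in theta i ->
    b.1 <= c.1 /\ c.2 <= b.2.
  by case=> _ sc bi; apply: sc.
have bounds i (b : box) : b \in theta i ->
    content (start i) <= content b <= content (fin i).
  move=> bi; have [_ eb] := ends i.
  have fb : (fin i).1 <= b.1 /\ b.2 <= (fin i).2 by apply: eb.
  by have := extreme i _ b (starts i) bi; move: fb; rewrite /content; lia.
have uniq i (b b' : box) : b \in theta i -> b' \in theta i ->
    content b = content b' -> b = b'.
  exact: strip_unique_content (strips i).
have prev i (b : box) : b \in theta i -> content (start i) < content b ->
    prev_box (d (content b)) b \in theta i.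
  move=> bi lt; apply: dprev => // sb; have [si _] := starts i.
  by have := extreme i _ _ sb si; move: lt; rewrite /content; lia.
split=> //.
- move=> i j b bi bj; apply/eqP; apply: contraT => /disj /fdisjointP /(_ b bi).
  by rewrite bj.
- by move=> i; have [si _] := starts i; have /andP [] := bounds i _ si.
- move=> i c /andP [sc cf]; rewrite -[c](subKr (content (fin i))).
  have [fi _] := ends i.
  have: (`|content (fin i) - c| <= `|content (fin i) - content (start i)|)%N by lia.
  have -> : content (fin i) - c = `|content (fin i) - c|%N by lia.
  (* Walk back from the ending box to the box of content c. *)
  elim: `|content (fin i) - c|%N => [|k IHk] kle.
    by exists (fin i); rewrite ?subr0.
  have [|b bi cb] := IHk; first by lia.
  exists (prev_box (d (content b)) b); last by rewrite content_prev; lia.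
  by apply: prev => //; have /andP [] := bounds i _ bi; lia.
- move=> i b bi cb.
  have sb : b = start i by apply: (uniq i) => //; have [] := starts i.
  have := dstart i b; rewrite {1}sb => /(_ (starts i)).
  by case: (d _) => /andP [].
Qed.

(** * The determinant formula *)

Unset Implicit Arguments.

Theorem theorem10p10 (R : realType) (lambda mu : seq nat) (N : nat)
    (s : box -> R[i]) (a : int -> R[i])
    (n : nat) (theta : 'I_n -> {fset box}) (start fin : 'I_n -> box)
    (d : int -> direction) :
  is_partition lambda -> is_partition mu ->
  diagram mu `<=` diagram lambda ->
  (0 < N)%N ->
  (forall b, b \in skew_diagram lambda mu -> s b = a (content b)) ->
  outside_decomposition (skew_diagram lambda mu) theta ->
  (forall i, is_starting_box (theta i) (start i)) ->
  (forall i, is_ending_box (theta i) (fin i)) ->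
  compatible_directions (skew_diagram lambda mu) theta d ->
  so_fun N (skew_diagram lambda mu) s =
  \det (\matrix_(i < n, j < n)
    sharp_entry N a (sharp d (content (fin i)) (content (start j)))).
Proof.
move=> plambda pmu _ _ sa outside starts ends dirs.
have dec := outside_strip_decomposition outside starts ends dirs.
rewrite (so_fun_det N (skew_diagram_convex plambda pmu) dec sa).
congr (\det _); apply/matrixP => i j; rewrite !mxE /sharp /strip_total.
case: leP => [pq|_]; last by case: eqP => //= _; rewrite eqxx.
rewrite /= (negPf (content_strip_neq0 d pq)).
rewrite (so_fun_det N (a := a) (content_strip_convex pq)
  (content_strip_decomposition d pq)) //.
by rewrite det_mx11 mxE /strip_total pq.
Qed.
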